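(* For every infinite cardinal $\kappa$ and every natural number $d>1$, $\chi_{\rm CF}(\beth_\omega(\kappa),\kappa,d)=\omega$.
   Context: $\beth_0(\kappa)=\kappa$, $\beth_{n+1}(\kappa)=2^{\beth_n(\kappa)}$, and $\beth_\omega(\kappa)=\sup_{n<\omega}\beth_n(\kappa)$. For a family $\mathcal A$ and cardinal $\rho$, $f:\bigcup\mathcal A\to\rho$ is a conflict free coloring of $\mathcal A$ if every $A\in\mathcal A$ contains exactly one point of some color class $f^{-1}\{\zeta\}$; $\chi_{\rm CF}(\mathcal A)$ is the least such $\rho$. A $(\lambda,\kappa,\mu)$-system is a family of $\lambda$ sets, each of size $\kappa$ (at least two elements), any two distinct of which meet in fewer than $\mu$ points; $\chi_{\rm CF}(\lambda,\kappa,\mu)$ is the supremum of $\chi_{\rm CF}(\mathcal A)$ over all $(\lambda,\kappa,\mu)$-systems $\mathcal A$. *)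

(* Defs.v *)
From HB Require Import structures.
From mathcomp Require Import all_boot all_order all_algebra.
From mathcomp Require Import boolp classical_sets functions cardinality.
Set Implicit Arguments. Unset Strict Implicit. Unset Printing Implicit Defensive.
Local Open Scope classical_set_scope.
Local Open Scope card_scope.

(* A cardinal kappa is represented by a type K (kappa = |K|).
   beth_type K n is a type of cardinality beth_n(|K|):
   beth_0 = K, beth_{n+1} = power set of beth_n. *)
Fixpoint beth_type (K : Type) (n : nat) : Type :=
  match n with
  | 0 => K
  | S m => set (beth_type K m)
  end.

Definition has_card_beth_omega (K : Type) (U : Type) (F : set U) : Prop :=
  (forall n : nat, [set: beth_type K n] #<= F) /\
  (forall (V : Type) (B : set V),
      (forall n : nat, [set: beth_type K n] #<= B) -> F #<= B).

Definition beth_omega_system (K : Type) (d : nat) (U : Type) (F : set (set U)) : Prop :=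
  has_card_beth_omega K F /\
  (forall A, F A -> A #= [set: K]) /\
  (forall A, F A -> ~ (A #<= `I_1)) /\
  (forall A B, F A -> F B -> A <> B -> ~ (`I_d #<= (A `&` B))).

Definition conflict_free (U C : Type) (f : U -> C) (F : set (set U)) : Prop :=
  forall A, F A -> exists z : C, exists! x : U, A x /\ f x = z.

(* Main.v *)
(* Upper bound: an incidence graph of an almost disjoint family contains no complete bipartite graph
   K(d, omega_1), so by an argument of Erdos and Hajnal points and sets can be well-ordered together
   with each of them having finitely many earlier neighbours; a greedy colouring along this order is
   conflict free. The size of the family plays no role.

   Lower bound: a system which is not j-colourable is turned into one which is not (j+1)-colourable.
   Every (j+1)-colouring uses all colours in each copy of the old system, so it suffices to add a set
   meeting many copies, each in at most one point, in points that realise every colour twice. The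
   place of a colour inside a copy is chosen by the colouring; indexing the new sets by tuples of
   functions lets one of them guess all the places correctly. This uses only finitely many power sets,
   and beth_omega many disjoint sets are added at the end. *)
Require Import Defs.
From HB Require Import structures.
From Stdlib Require Inverse_Image.
From mathcomp Require Import all_boot all_order all_algebra.
From mathcomp Require Import boolp classical_sets functions cardinality.
From mathcomp Require wochoice.
Local Open Scope classical_set_scope.
Local Open Scope card_scope.
Set Implicit Arguments.
Unset Strict Implicit.

(** * Cardinality *)

Definition embeds (X Y : Type) : Prop := exists f : X -> Y, injective f.

Lemma sval_inj (T : Type) (P : T -> Prop) : injective (@sval T P).
Proof. by move=> [x Px] [y Py] /= e; apply: eq_exist. Qed.

Lemma embeds_trans (X Y Z : Type) : embeds X Y -> embeds Y Z -> embeds X Z.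
Proof. by move=> [f fi] [g gi]; exists (g \o f); apply: inj_comp. Qed.

Lemma card_le_embeds (T U : Type) (A : set T) (B : set U) :
  A #<= B <-> embeds {x | A x} {y | B y}.
Proof.
have [sA [tA [stA tsA]]] : exists (s : {x | A x} -> A) t, cancel s t /\ cancel t s.
  exists (fun u => exist _ (sval u) (mem_set (svalP u))).
  exists (fun u => exist _ (sval u) (set_mem (svalP u))).
  by split=> -[x p] /=; apply: eq_exist.
have [sB [tB [stB tsB]]] : exists (s : {x | B x} -> B) t, cancel s t /\ cancel t s.
  exists (fun u => exist _ (sval u) (mem_set (svalP u))).
  exists (fun u => exist _ (sval u) (set_mem (svalP u))).
  by split=> -[x p] /=; apply: eq_exist.
split=> [/card_leP[f]|[f fi]].
  exists (tB \o f \o sA) => x y /= /(can_inj tsB) /(@inj _ _ _ f).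
  by rewrite !in_setT => /(_ isT isT) /(can_inj stA).
apply/card_leP/injfunPex; exists (sB \o f \o tA) => // x y _ _ /=.
by move=> /(can_inj stB) /fi /(can_inj tsA).
Qed.

Lemma cardT_le_embeds (X U : Type) (B : set U) :
  [set: X] #<= B <-> embeds X {y | B y}.
Proof.
rewrite card_le_embeds; split=> [[f fi]|[f fi]].
  by exists (fun x => f (exist _ x I)) => x y /fi [].
exists (fun u => f (projT1 u)) => -[x Ax] [y Ay] /= /fi e.
exact: eq_exist.
Qed.

(* Kuratowski pairs: they keep products inside finitely many power sets without cardinal arithmetic. *)
Lemma embeds_prod_setset (X : Type) : embeds (X * X) (set (set X)).
Proof.
exists (fun u => [set [set u.1]; [set u.1; u.2]]) => -[x y] [x' y'] /= e.
have ex : x = x'.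
  have : [set [set x']; [set x'; y']] [set x] by rewrite -e; left.
  move=> [] e1; have : [set x] x' by rewrite e1 //; left.
    by [].
  by [].
move: e; rewrite -{}ex => e; congr pair.
have : [set [set x]; [set x; y']] [set x; y] by rewrite -e; right.
have : [set [set x]; [set x; y]] [set x; y'] by rewrite e; right.
move=> [] e1 [] e2.
- have : [set x] y by rewrite -e2; right.
  have : [set x] y' by rewrite -e1; right.
  by move=> /= -> ->.
- have : [set x; y'] y by rewrite -e2; right.
  move=> /= [] // ->; have : [set x] y' by rewrite -e1; right.
  by move=> /= ->.
- have : [set x] y by rewrite -e2; right.
  move=> /= ->; have : [set x; y] y' by rewrite -e1; right.
  by move=> /= [] // ->; have : [set x] y by rewrite -e2; right.
- have : [set x; y'] y by rewrite -e2; right.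
  have : [set x; y] y' by rewrite -e1; right.
  by move=> /= [] -> // [] ->.
Qed.

(** Stands for size below beth_omega of [K]; its closure properties replace cardinal arithmetic. *)
Definition beth_small (K X : Type) : Prop := exists n, embeds X (beth_type K n).

Lemma beth_small_embeds (K X Y : Type) : embeds X Y -> beth_small K Y -> beth_small K X.
Proof. by move=> XY [n Yn]; exists n; apply: embeds_trans Yn. Qed.

Lemma embeds_beth_type_le (K : Type) (m n : nat) : m <= n -> embeds (beth_type K m) (beth_type K n).
Proof.
move=> /subnK <-; elim: (n - m) => [|p IH]; first by exists id.
apply: embeds_trans IH _; exists (@set1 _) => x y e.
by have : [set y] x by rewrite -e.
Qed.

Lemma embeds_set (X Y : Type) : embeds X Y -> embeds (set X) (set Y).
Proof.
move=> [f fi]; exists (image^~ f) => A B e; apply: funext => x; apply: propext.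
by rewrite -(image_inj (A := A) fi) e image_inj.
Qed.

Lemma beth_small_set (K X : Type) : beth_small K X -> beth_small K (set X).
Proof. by move=> [n /embeds_set Xn]; exists n.+1. Qed.

Lemma beth_small_prod (K X Y : Type) : beth_small K X -> beth_small K Y -> beth_small K (X * Y).
Proof.
move=> [m Xm] [n Yn].
have [f fi] : embeds X (beth_type K (maxn m n)).
  by apply: embeds_trans Xm _; apply/embeds_beth_type_le/leq_maxl.
have [g gi] : embeds Y (beth_type K (maxn m n)).
  by apply: embeds_trans Yn _; apply/embeds_beth_type_le/leq_maxr.
exists (maxn m n).+2; apply: embeds_trans (@embeds_prod_setset _).
by exists (fun u => (f u.1, g u.2)) => -[x y] [x' y'] [] /fi -> /gi ->.
Qed.

Lemma beth_small_fun (K X Y : Type) : beth_small K X -> beth_small K Y -> beth_small K (X -> Y).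
Proof.
move=> sX sY; apply: beth_small_embeds (beth_small_set (beth_small_prod sX sY)).
exists (fun f => [set u | f u.1 = u.2]) => f g e; apply: funext => x.
by have : [set u | f u.1 = u.2] (x, f x) by []; rewrite e.
Qed.

Lemma beth_small_base (K : Type) : beth_small K K.
Proof. by exists 0; exists id. Qed.

Lemma beth_small_countType (K : Type) (X : countType) :
  infinite_set [set: K] -> beth_small K X.
Proof.
move=> /infiniteP /cardT_le_embeds[f fi]; exists 0.
exists (fun x => sval (f (pickle x))) => x y /sval_inj /fi.
exact: pcan_inj pickleK _ _.
Qed.

Lemma beth_small_sum (K X Y : Type) : infinite_set [set: K] ->
  beth_small K X -> beth_small K Y -> beth_small K (X + Y).
Proof.
move=> hK sX sY.
have sO Z : beth_small K Z -> beth_small K (option Z).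
  move=> sZ; apply: beth_small_embeds (beth_small_set sZ).
  exists (fun o => if o is Some z then [set z] else set0) => -[x|] [y|] //= e.
  - by congr Some; have : [set y] x by rewrite -e.
  - by have : set0 x by rewrite -e.
  - by have : set0 y by rewrite e.
apply: beth_small_embeds (beth_small_prod (sO _ sX) (sO _ sY)).
exists (fun u => match u with inl x => (Some x, None) | inr y => (None, Some y) end).
by move=> [x|y] [x'|y'] //= [] ->.
Qed.

(** * Systems without conflict free colourings by finitely many colours *)

(* An argument [a : P] is a tuple whose [i]-th coordinate is an arbitrary [S]-valued function of
   the earlier ones; [r i a] is the value of that function at [a], and [x i a] is [a] without its
   [i]-th coordinate. *)
Lemma diagonal_tuples (K S : Type) (s0 : S) (k : nat) : infinite_set [set: K] -> beth_small K S ->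
  exists (P X : Type) (x : nat -> P -> X) (r : nat -> P -> S),
  [/\ beth_small K P /\ beth_small K X,
      forall i i' a a', i < k -> i' < k -> x i a = x i' a' -> i = i',
      forall i i' a a', i < k -> i' < k -> i <> i' -> x i a = x i a' -> x i' a = x i' a' -> a = a'
    & forall g : nat -> X -> S, exists a, forall i, i < k -> r i a = g i (x i a)].
Proof.
move=> hK sS; elim: k => [|k [P [X [x [r [[sP sX] xI xJ xG]]]]]].
  exists unit, unit, (fun _ _ => tt), (fun _ _ => s0); split=> [|//|//|g].
    by split; exact: beth_small_countType hK.
  by exists tt.
have sF : beth_small K (P -> S) by exact: beth_small_fun.
(* The new last coordinate is a function on [P]. Dropping it leaves an element of [P], and the sum
   keeps apart the results of dropping different coordinates. *)
exists (P * (P -> S))%type, (X * (P -> S) + P)%type,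
  (fun i u => if i == k then inr u.1 else inl (x i u.1, u.2)),
  (fun i u => if i == k then u.2 u.1 else r i u.1).
have ltk i : i < k.+1 -> i != k -> i < k by move=> ik nik; rewrite ltn_neqAle nik -ltnS.
split.
- split; first exact: beth_small_prod.
  by apply: beth_small_sum => //; exact: beth_small_prod.
- move=> i i' [a b] [a' b'] /ltk ik /ltk ik' /=.
  have [->|/ik {}ik] := eqVneq i k; have [->|/ik' {}ik'] := eqVneq i' k => //.
  by move=> [] /xI e _; apply: e.
- move=> i i' [a b] [a' b'] /ltk ik /ltk ik' /=.
  have [->|/ik {}ik] := eqVneq i k; have [->|/ik' {}ik'] := eqVneq i' k => //.
  + by move=> _ [] ea [] _ eb; rewrite ea eb.
  + by move=> _ [] _ eb [] ea; rewrite ea eb.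
  + by move=> ii' [] /xJ e eb [] /e ea _; rewrite ea // eb.
(* The last coordinate [b] is chosen first, from [g k]; the induction hypothesis then meets the
   other demands with [b] held fixed. *)
- move=> g; pose b a := g k (inr a).
  have [a aG] := xG (fun i y => g i (inl (y, b))).
  by exists (a, b) => i /ltk ik /=; have [->|/ik/aG] := eqVneq i k.
Qed.

(** Enumerating each set by [K] builds in its size; the second clause says that two sets share at
    most one point. *)
Definition linear_system (K U T : Type) (h : T -> K -> U) : Prop :=
  (forall t, injective (h t)) /\
  (forall t t' x x' y y', t <> t' -> h t x = h t' y -> h t x' = h t' y' -> x = x').

Definition cf_colouring (K U T C : Type) (h : T -> K -> U) (f : U -> C) : Prop :=
  forall t, exists z, exists! y, f (h t y) = z.

(** Serves to recognise the positions of a new set that are reserved for points in old copies. *)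
Lemma partial_inverse (K : Type) (q : nat -> K) (k : nat) : injective q ->
  exists s : K -> option nat, forall y i, s y = Some i <-> i < k /\ q i = y.
Proof.
move=> qI.
suff /choice[s sE] : forall y, exists o, forall i, o = Some i <-> i < k /\ q i = y by exists s.
move=> y.
have [[i [ik e]]|n] := pselect (exists i, i < k /\ q i = y); last first.
  by exists None => i; split=> // qi; case: n; exists i.
exists (Some i) => j; split=> [[<-] //|[jk e']]; congr Some; apply: qI; by rewrite e e'.
Qed.

(* A system for [j] colours is copied along [X]; by induction each copy realises all [j.+1] colours.
   The new set attached to [a : P] has one point in each of [2 * j.+1] copies, and a suitable [a]
   makes these points realise every colour twice. *)
Lemma uncolourable_system (K : Type) (j : nat) : infinite_set [set: K] ->
  exists (U T : Type) (h : T -> K -> U),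
  [/\ beth_small K U, beth_small K T, inhabited U, linear_system h
    & forall f : U -> 'I_j, ~ cf_colouring h f].
Proof.
move=> hK; elim: j => [|j [S [T [h [sS sT [s0] [hI hL] hC]]]]].
  (* Without colours a nonempty set of points has no colouring at all, so an empty family serves. *)
  exists unit, void, (fun t _ => tt); split.
  - exact: beth_small_countType hK.
  - exact: beth_small_countType hK.
  - exact: inhabits tt.
  - by split.
  - by move=> f; have [] := f tt.
have [q qI] : exists q : nat -> K, injective q.
  move: hK => /infiniteP /cardT_le_embeds[q qI]; exists (fun i => sval (q i)).
  by move=> i i' /sval_inj /qI.
have [P [X [x [r [[sP sX] xI xJ xG]]]]] := diagonal_tuples s0 (j.+1 + j.+1) hK sS.
have [s sE] := partial_inverse (j.+1 + j.+1) qI.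
(* Position [q i] holds the point [r i a] of the copy [x i a]; all other positions hold points
   private to [a]. *)
pose p a y : X * S + P * K :=
  if s y is Some i then inl (x i a, r i a) else inr (a, y).
pose H (v : X * T + P) y := match v with
  | inl u => inl (u.1, h u.2 y) | inr a => p a y end.
exists (X * S + P * K)%type, (X * T + P)%type, H.
have pinv a a' y y' : p a y = p a' y' ->
    (exists i, [/\ s y = Some i, s y' = Some i, i < j.+1 + j.+1 & x i a = x i a']) \/ (a = a' /\ y = y').
  rewrite /p; case e: (s y) => [i|]; case e': (s y') => [i'|] //; last by case; right.
  have [ik _] := (sE _ _).1 e; have [ik' _] := (sE _ _).1 e'.
  move=> [] exx _; have ii' := xI _ _ _ _ ik ik' exx; left; exists i.
  by split=> //; [rewrite ii' | rewrite exx ii'].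
have sinj y y' i : s y = Some i -> s y' = Some i -> y = y'.
  by move=> /sE[_ <-] /sE[_ <-].
split.
- by apply: beth_small_sum => //; apply: beth_small_prod => //; exact: beth_small_base.
- by apply: beth_small_sum => //; exact: beth_small_prod.
- have [a _] := xG (fun _ _ => s0); exact: inhabits (inr (a, q 0)).
- split=> [[[w t]|a] y y' /=|].
  + by move=> [] /hI.
  + by case/pinv => [[i [e e' _ _]]|[]//]; exact: sinj e e'.
  (* A new set visits a copy at most once, since the value [x i a] determines [i]; so it meets an
     old set in at most one point. *)
  + have mixed w t a y z y' z' : inl (w, h t y) = p a z -> inl (w, h t y') = p a z' -> y = y' /\ z = z'.
      rewrite /p; case e: (s z) => [i|] //; case e': (s z') => [i'|] //.
      move=> [] -> e1 [] exx e2.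
      have [ik _] := (sE _ _).1 e; have [ik' _] := (sE _ _).1 e'.
      have ii' := xI _ _ _ _ ik ik' exx; rewrite -ii' in e' e2.
      by split; [apply: (hI t); rewrite e1 e2|exact: sinj e e'].
    move=> [[w t]|a] [[w' t']|a'] y y' z z' ne /=.
    * move=> [] ew e1 [] _ e2; apply: hL e1 e2 => tt'; apply: ne; by rewrite ew tt'.
    * by move=> e1 e2; case: (mixed _ _ _ _ _ _ _ e1 e2).
    * by move=> /esym e1 /esym e2; case: (mixed _ _ _ _ _ _ _ e1 e2).
    * have na : a <> a' by move=> e; apply: ne; rewrite e.
      (* Meeting at two positions would make the tuples agree after dropping either of two
         coordinates, hence be equal. *)
      move=> /pinv[[i [e e1 ik ex]]|[//]] /pinv[[i' [e' e1' ik' ex']]|[//]].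
      have [ii'|ii'] := pselect (i = i'); first by apply: sinj e _; rewrite ii'.
      by case: na; exact: xJ ii' ex ex'.
move=> f fC.
(* If a copy missed the colour [z], removing [z] from the palette would leave a conflict free
   colouring of the old system by [j] colours. *)
have onto w (z : 'I_j.+1) : exists u, f (inl (w, u)) = z.
  apply: contrapT => nz.
  have /choice[g gE] : forall u, exists c : 'I_j, f (inl (w, u)) = lift z c.
    move=> u; have : z != f (inl (w, u)) by apply/eqP => e; apply: nz; exists u.
    by move=> /unlift_some[c -> _]; exists c.
  apply: (hC g) => t; have [z' [y [yz yU]]] := fC (inl (w, t)).
  exists (g (h t y)), y; split=> // y' gy'; apply: yU.
  by rewrite -yz /= !gE gy'.
(* The remainder assigns the colour [z] to both positions [z] and [z + j.+1], so no colour is unique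
   on the new set. *)
pose col i : 'I_j.+1 := inord (i %% j.+1).
have /choice[pt ptE] : forall v : nat * X, exists u, f (inl (v.2, u)) = col v.1 by move=> v; exact: onto.
have [a aG] := xG (fun i w => pt (i, w)).
have fq i : i < j.+1 + j.+1 -> f (p a (q i)) = col i.
  move=> ik; have e : s (q i) = Some i by apply/sE.
  by rewrite /p e aG // (ptE (i, x i a)).
have [z [y [_ yU]]] := fC (inr a).
have zk : z < j.+1 + j.+1 by rewrite ltn_addr.
have zk' : z + j.+1 < j.+1 + j.+1 by rewrite ltn_add2r.
have cz : col z = z by apply: val_inj; rewrite /= inordK ?modn_small // ltn_pmod.
have cz' : col (z + j.+1) = z by rewrite -[RHS]cz /col modnDr.
have := etrans (esym (yU _ (etrans (fq _ zk) cz))) (yU _ (etrans (fq _ zk') cz')).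
by move=> /qI /eqP; rewrite -[X in X == _]addn0 eqn_add2l.
Qed.

(* Cantor's diagonal argument: an injection of [set V * Z] into [Y] has a fibre [{s} * Z] which
   misses the range of [H]. *)
Lemma embeds_avoiding (K V Z Y : Type) (H : V -> Y) :
  beth_small K V -> beth_small K Z -> (forall n, embeds (beth_type K n) Y) ->
  exists2 h : Z -> Y, injective h & forall v z, H v <> h z.
Proof.
move=> sV sZ hY; have [n sn] := beth_small_prod (beth_small_set sV) sZ.
have [G Gi] := embeds_trans sn (hY n).
(* If [H v = G (s, z)], injectivity of [G] makes [v] belong to [s] exactly when it does not. *)
pose s : set V := [set v | forall s z, H v = G (s, z) -> ~ s v].
exists (fun z => G (s, z)) => [z z' /Gi [] //|v z Hv].
have ns : ~ s v by move=> sv; exact: (sv _ _ Hv).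
by apply: (ns) => s' z' Hv'; move: Hv; rewrite Hv' => /Gi [] ->.
Qed.

(** Stage [n] places [W n] off the images of the earlier stages. This gives the minimality clause
    for beth_omega: a sum of small types fits into whatever contains every beth_n. *)
Lemma embeds_sigma (K Y : Type) (W : nat -> Type) :
  infinite_set [set: K] -> (forall n, beth_small K (W n)) ->
  (forall n, embeds (beth_type K n) Y) -> embeds {n & W n} Y.
Proof.
move=> hK sW hY.
pose V := nat_rect (fun _ => Type) void (fun n Vn => (Vn + W n)%type).
have sV n : beth_small K (V n).
  elim: n => [|n IH]; first exact: beth_small_countType hK.
  exact: beth_small_sum.
have [st stE] : exists st : forall n, (V n -> Y) -> W n -> Y,
    forall n H, injective (st n H) /\ forall v z, H v <> st n H z.
  have ex n (H : V n -> Y) : {h : W n -> Y | injective h /\ forall v z, H v <> h z}.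
    by apply: cid; have [h] := embeds_avoiding H (sV n) (sW n) hY; exists h.
  by exists (fun n H => sval (ex n H)) => n H; exact: svalP (ex n H).
pose H := nat_rect (fun n => V n -> Y) (of_void Y)
  (fun n Hn v => match v with inl u => Hn u | inr w => st n Hn w end).
have range_H m n w : m < n -> exists v, H n v = st m (H m) w.
  elim: n => // n IH; rewrite ltnS leq_eqVlt => /orP[/eqP <-|/IH[v <-]].
    by exists (inr w).
  by exists (inl v).
exists (fun u => st (projT1 u) (H (projT1 u)) (projT2 u)) => -[m w] [n z] /= e.
have [mn|nm|mn] := ltngtP m n.
- by have [v] := range_H _ _ w mn; rewrite e => /(stE n (H n)).2.
- by have [v] := range_H _ _ z nm; rewrite -e => /(stE m (H m)).2.
- by move: w e; rewrite mn => w /(stE n (H n)).1 ->.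
Qed.

Lemma uncolourable_beth_omega_system (K : Type) (d n : nat) : infinite_set [set: K] -> 1 < d ->
  exists (U : Type) (F : set (set U)),
    beth_omega_system K d F /\ ~ (exists f : U -> 'I_n, conflict_free f F).
Proof.
move=> hK hd.
have [U0 [T0 [h0 [_ sT _ [hI0 hL0] hC]]]] := uncolourable_system n hK.
pose Z := {m & beth_type K m}.
pose U := (U0 + Z * K)%type; pose T := (T0 + Z)%type.
pose h (t : T) (y : K) : U := match t with inl t => inl (h0 t y) | inr z => inr (z, y) end.
have hI t : injective (h t).
  by case: t => [t|z] y y' /= [] // /hI0.
have hL t t' x x' y y' : t <> t' -> h t x = h t' y -> h t x' = h t' y' -> x = x'.
  move: t t' => [t|z] [t'|z'] //= ne.
    by move=> [] e1 [] e2; apply: hL0 e1 e2 => tt'; apply: ne; rewrite tt'.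
  by move=> [] e; case: ne; rewrite e.
have [q qI] : embeds nat K.
  move: hK => /infiniteP /cardT_le_embeds[q qI]; exists (fun i => sval (q i)).
  by move=> i i' /sval_inj /qI.
(* Equal ranges would share the two points at [q 0] and [q 1]. Hence the family is as large as its
   index type. *)
have rI t t' : range (h t) = range (h t') -> t = t'.
  move=> e; apply: contrapT => ne.
  have [z _ ez] : range (h t') (h t (q 0)) by rewrite -e; exists (q 0).
  have [z' _ ez'] : range (h t') (h t (q 1)) by rewrite -e; exists (q 1).
  by have /qI := hL _ _ _ _ _ _ ne (esym ez) (esym ez').
pose F : set (set U) := range (fun t => range (h t)).
have FT t : F (range (h t)) by exists t.
have cardF A : F A -> A #= [set: K].
  by move=> [t _ <-]; apply: inj_card_eq => x y _ _ /hI.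
exists U, F; split; last first.
  move=> [f fF]; apply: (hC (f \o inl)) => t.
  have [z [x [[[y _ <-] fy] xU]]] := fF _ (FT (inl t)).
  exists z, y; split=> // y' fy'; apply: (hI (inl t)).
  by apply: xU; split=> //; exists y'.
split; last split=> //; last split.
- split=> [m|V B hB].
    apply/cardT_le_embeds; exists (fun x => exist _ _ (FT (inr (existT _ m x)))) => x y e.
    have e' : range (h (inr (existT _ m x))) = range (h (inr (existT _ m y))) by exact: (congr1 sval e).
    by have [e2] := rI _ _ e'; exact: (@eq_from_Tagged nat (beth_type K) m x y e2).
  apply/card_le_embeds.
  have hY m : embeds (beth_type K m) {y | B y} by apply/cardT_le_embeds.
  (* Index 0 takes the uncolourable part, so the beth levels move up by one. *)
  pose W m := if m is p.+1 then beth_type K p else T0.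
  have sW m : beth_small K (W m) by case: m => // p; exists p; exists id.
  apply: embeds_trans (embeds_sigma hK sW hY).
  have ex (A : {A | F A}) : exists t, sval A = range (h t).
    by have [t _ e] := svalP A; exists t.
  have [g gE] := choice ex.
  pose w (t : T) := match t with inl t => existT W 0 t | inr (existT m x) => existT W m.+1 x end.
  have wI : injective w.
    move=> [t|[m x]] [t'|[m' x']] //= e; first by rewrite (@eq_from_Tagged nat _ _ _ _ e).
    have [mm] := congr1 (@projT1 _ _) e.
    move: x' e; rewrite -mm => x' e; congr (inr (existT _ m _)).
    exact: (@eq_from_Tagged nat W m.+1 x x' e).
  exists (w \o g) => A B' /= /wI gAB.
  by apply: sval_inj; rewrite !gE gAB.
- move=> A /cardF cA; move=> /card_le_finite /(_ (finite_II 1)).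
  by rewrite (eq_finite_set cA) => /hK.
- move=> A B [t _ <-] [t' _ <-] ne /card_le_embeds[g gI].
  pose i0 : {x | `I_d x} := exist _ 0 (ltnW hd).
  pose i1 : {x | `I_d x} := exist _ 1 hd.
  have [[y _ ey] [z _ ez]] := svalP (g i0).
  have [[y' _ ey'] [z' _ ez']] := svalP (g i1).
  have ntt : t <> t' by move=> e; apply: ne; rewrite e.
  have yy := hL _ _ _ _ _ _ ntt (etrans ey (esym ez)) (etrans ey' (esym ez')).
  have : sval (g i0) = sval (g i1) by rewrite -ey -ey' yy.
  by move=> /sval_inj /gI.
Qed.

(** * Well-orders *)

(** A strict order; totality and transitivity come from least elements of sets of two and three
    points. *)
Definition well_orders (V : Type) (W : set V) (R : V -> V -> Prop) : Prop :=
  (forall A, A `<=` W -> A !=set0 -> exists2 x, A x & forall y, A y -> y <> x -> R x y) /\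
  (forall x y, W x -> W y -> R x y -> ~ R y x).

Lemma well_orders_exists (V : Type) : exists R : V -> V -> Prop, well_orders setT R.
Proof.
have [R hR] := wochoice.well_ordering_principle {classic V}.
exists (fun x y => x <> y /\ R x y).
split=> [A _ [x Ax]|x y _ _ [xy Rxy] [_ Ryx]].
  have [|z [[Az zmin] _]] := hR [pred x | `[< A x >]]; first by exists x; apply/asboolP.
  exists z; first exact/asboolP.
  by move=> y Ay yz; split; [exact/nesym|apply: zmin; exact/asboolP].
have refl u : R u u.
  have [|z [[/asboolP /= <- zmin] _]] := hR [pred x | `[< x = u >]].
    by exists u; apply/asboolP.
  by apply: zmin; apply/asboolP.
(* Both [x] and [y] would be least in the pair, against uniqueness of the minimum. *)
have [|z [_ zU]] := hR [pred u | `[< u = x \/ u = y >]].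
  by exists x; apply/asboolP; left.
apply: xy; apply: (@eq_trans _ _ z); [apply/esym|]; apply: zU; split.
- by apply/asboolP; left.
- by move=> u /asboolP[->|->].
- by apply/asboolP; right.
- by move=> u /asboolP[->|->].
Qed.

Lemma well_orders_total (V : Type) (W : set V) (R : V -> V -> Prop) (x y : V) :
  well_orders W R -> W x -> W y -> x <> y -> R x y \/ R y x.
Proof.
move=> [hmin _] Wx Wy xy.
have [|| z [] -> zmin] := hmin [set x; y]; first by move=> _ [] ->.
- by exists x; left.
- by left; apply: zmin; [right|exact/nesym].
- by right; apply: zmin; [left|].
Qed.

Lemma well_orders_trans (V : Type) (R : V -> V -> Prop) (x y z : V) :
  well_orders setT R -> R x y -> R y z -> R x z.
Proof.
move=> hR Rxy Ryz; have [hmin asym] := hR.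
have [xz|xz] := pselect (x = z).
  by move: Ryz; rewrite -xz => Ryx; case: (asym x y I I Rxy).
have [//|Rzx] := well_orders_total hR I I xz.
have ne u v : R u v -> v <> u by move=> Ruv e; move: (Ruv); rewrite e => Ruu; apply: (asym u u I I Ruu).
have [|| w /= hw wmin] := hmin [set x; y; z]; [by []|by exists x; left; left|].
case: hw wmin => [[] |] -> wmin.
- have Rxz : R x z by apply: wmin; [right|exact/nesym].
  by [].
- have Ryx : R y x by apply: wmin; [left; left|exact/nesym/ne].
  by case: (asym x y I I Rxy).
- have Rzy : R z y by apply: wmin; [left; right|exact/nesym/ne].
  by case: (asym y z I I Ryz).
Qed.

Lemma well_orders_wf (V : Type) (R : V -> V -> Prop) : well_orders setT R -> well_founded R.
Proof.
move=> hR x; apply: contrapT => nx; have [hmin asym] := hR.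
have [|| z nz zmin] := hmin [set z | ~ Acc R z]; [by []|by exists x|].
apply: nz; apply: Acc_intro => y Ryz; apply: contrapT => ny.
have [e|ne] := pselect (y = z).
  by move: (Ryz); rewrite e => Rzz; exact: (asym z z I I Rzz).
exact: (asym y z I I Ryz (zmin _ ny ne)).
Qed.

Lemma finite_set_directed (I V : Type) (J : set I) (C : I -> set V) (A : set V) :
  (forall b c, J b -> J c -> exists m, [/\ J m, C b `<=` C m & C c `<=` C m]) ->
  J !=set0 -> finite_set A -> A `<=` \bigcup_(b in J) C b -> exists2 b, J b & A `<=` C b.
Proof.
move=> dir [b0 Jb0] [n]; elim: n A => [|n IH] A.
  by rewrite II0 card_eq0 => /eqP -> _; exists b0.
move=> /eq_cardSP[x Ax An] AC.
have [b Jb Ab] : exists2 b, J b & A `\ x `<=` C b by apply: IH => // y [/AC].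
have [c Jc Cx] := AC x Ax; have [m [Jm bm cm]] := dir b c Jb Jc.
exists m => // y Ay; have [->|yx] := pselect (y = x); first exact: cm.
exact/bm/Ab.
Qed.

Lemma infinite_subset_II (V : Type) (N : set V) (d : nat) :
  infinite_set N -> exists2 A, A `<=` N & A #= `I_d.
Proof.
move=> /infiniteP /cardT_le_embeds[g gI].
exists ((sval \o g) @` `I_d); first by move=> _ [i _ <-]; exact: (svalP (g i)).
by apply: inj_card_eq => i j _ _ /sval_inj /gI.
Qed.

(** * Graphs in which every vertex has finitely many earlier neighbours *)

(** A vertex outside a closed set has fewer than [d] neighbours in it; this is the source of finite
    back degrees. *)
Definition graph_closed (V : Type) (adj : V -> V -> Prop) (d : nat) (W : set V) : Prop :=
  forall v A, A `<=` W -> A #= `I_d -> A `<=` adj v -> W v.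

Definition graph_closure (V : Type) (adj : V -> V -> Prop) (d : nat) (X : set V) : set V :=
  [set v | forall W, graph_closed adj d W -> X `<=` W -> W v].

Definition finite_back_degree (V : Type) (adj : V -> V -> Prop) (W : set V)
    (R : V -> V -> Prop) : Prop :=
  forall x, W x -> finite_set [set y | [/\ W y, R y x & adj x y]].

Definition orderable (V : Type) (adj : V -> V -> Prop) (W : set V) : Prop :=
  exists2 R, well_orders W R & finite_back_degree adj W R.

Lemma orderable_sub (V : Type) (adj : V -> V -> Prop) (W W' : set V) :
  W `<=` W' -> orderable adj W' -> orderable adj W.
Proof.
move=> WW' [R [hmin asym] fin]; exists R.
  split=> [A AW|x y Wx Wy]; first by apply: hmin; exact: subset_trans WW'.
  by apply: asym; exact: WW'.
move=> x /WW' /fin; apply: sub_finite_set => y [Wy Ryx xy]; split=> //; exact: WW'.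
Qed.

Lemma countable_orderable (V : Type) (adj : V -> V -> Prop) (W : set V) : countable W -> orderable adj W.
Proof.
move=> /card_le_embeds[g gI].
have [f fI] : exists f : V -> nat, {in W &, injective f}.
  exists (fun x => if pselect (W x) is left Wx then sval (g (exist _ x Wx)) else 0).
  move=> x y; rewrite !inE => Wx Wy; case: pselect => // Wx'; case: pselect => // Wy'.
  by move=> /sval_inj /gI [].
exists (fun x y => f x < f y).
  split=> [A AW [x Ax]|x y _ _ xy]; last by rewrite ltnNge ltnW.
  have ex : exists n, `[< exists2 y, A y & f y = n >].
    by exists (f x); apply/asboolP; exists x.
  have [n /asboolP[y Ay <-] nmin] := ex_minnP ex.
  exists y => // z Az zy; rewrite ltn_neqAle nmin ?andbT; last by apply/asboolP; exists z.
  by apply/eqP => /fI e; apply: zy; apply/esym/e; rewrite inE; exact: AW.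
move=> x Wx; apply/finite_set_leP; exists (f x).
have fyx y : [set y | [/\ W y, f y < f x & adj x y]] y -> `I_(f x) (f y) by move=> [].
apply/card_le_embeds.
exists (fun u => exist _ (f (sval u)) (fyx _ (svalP u))) => -[y [Wy ? ?]] [z [Wz ? ?]] /= [].
by move=> /fI e; apply/sval_inj/e; rewrite inE.
Qed.

Lemma countable_setU (V : Type) (A B : set V) :
  countable A -> countable B -> countable (A `|` B).
Proof. by move=> cA cB; rewrite -bigcup2E; apply: bigcup_countable => // -[|[|i]]. Qed.

Lemma graph_closureS (V : Type) (adj : V -> V -> Prop) (d : nat) (X : set V) :
  X `<=` graph_closure adj d X.
Proof. by move=> v Xv W _; apply. Qed.

Lemma graph_closure_closed (V : Type) (adj : V -> V -> Prop) (d : nat) (X : set V) :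
  graph_closed adj d (graph_closure adj d X).
Proof.
move=> v A AX Ad Av W cW XW; apply: (cW v A) => //.
by move=> a /AX; apply.
Qed.

Lemma graph_closure_sub (V : Type) (adj : V -> V -> Prop) (d : nat) (X W : set V) :
  graph_closed adj d W -> X `<=` W -> graph_closure adj d X `<=` W.
Proof. by move=> cW XW v; apply. Qed.

Lemma graph_closed_directed (I V : Type) (adj : V -> V -> Prop) (d : nat) (J : set I)
    (C : I -> set V) : 0 < d ->
  (forall b c, J b -> J c -> exists m, [/\ J m, C b `<=` C m & C c `<=` C m]) ->
  (forall b, J b -> graph_closed adj d (C b)) ->
  graph_closed adj d (\bigcup_(b in J) C b).
Proof.
move=> d0 dir cC v A AC Ad Av.
have fA : finite_set A by exists d.
have J0 : J !=set0.
  case: d d0 Ad {cC} => // d _ /eq_cardSP[x /AC[b Jb _] _]; by exists b.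
have [b Jb Ab] := finite_set_directed dir J0 fA AC.
by exists b => //; exact: cC Ab Ad Av.
Qed.

(** Excludes a complete bipartite graph K(d, omega_1). *)
Definition sparse (V : Type) (adj : V -> V -> Prop) (d : nat) : Prop :=
  forall A, A #= `I_d -> countable [set v | A `<=` adj v].

(** Countably many [d]-subsets, each with countably many common neighbours, keep every step
    countable. After omega steps the union is closed, as a finite subset of it lies in one stage. *)
Lemma countable_graph_closure (V : Type) (adj : V -> V -> Prop) (d : nat) (X : set V) :
  0 < d -> sparse adj d -> countable X -> countable (graph_closure adj d X).
Proof.
move=> d0 sp cX.
pose step (Y : set V) := Y `|` \bigcup_(A in [set A | A `<=` Y /\ A #= `I_d]) [set v | A `<=` adj v].
pose Y := fix Y n := if n is m.+1 then step (Y m) else X.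
have cY n : countable (Y n).
  elim: n => //= n IH; apply: countable_setU => //.
  apply: bigcup_countable; first exact: countable_n_subset.
  by move=> A [_]; exact: sp.
have Yle m n : m <= n -> Y m `<=` Y n.
  move=> /subnK <-; elim: (n - m) => //= k IH v /IH; by left.
have cl : graph_closed adj d (\bigcup_n Y n).
  move=> v A AY Ad Av; have fA : finite_set A by exists d.
  have [||n _ An] := @finite_set_directed _ _ setT Y A _ _ fA AY.
  - by move=> b c _ _; exists (maxn b c); split=> //; apply: Yle; rewrite ?leq_maxl ?leq_maxr.
  - by exists 0.
  - by exists n.+1 => //; right; exists A.
apply: (@sub_countable _ _ _ (\bigcup_n Y n)); last exact: bigcup_countable.
apply: subset_card_le; apply: graph_closure_sub => //.
by move=> v Xv; exists 0.
Qed.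

(* Vertices are ordered first by the index at which they enter the chain. A vertex entering at [b]
   has finitely many neighbours in the closed union of the earlier members, as it is not in there. *)
Lemma orderable_chain (T V : Type) (adj : V -> V -> Prop) (d : nat) (lt : T -> T -> Prop) (J : set T)
    (C : T -> set V) : 0 < d -> well_orders setT lt ->
  (forall b c, J b -> J c -> lt b c -> C b `<=` C c) ->
  (forall b, J b -> graph_closed adj d (C b)) -> (forall b, J b -> orderable adj (C b)) ->
  orderable adj (\bigcup_(b in J) C b).
Proof.
move=> d0 hlt mono cC gC; have [hmin asym] := hlt.
have /choice[Q hQ] : forall b, exists R, J b -> well_orders (C b) R /\ finite_back_degree adj (C b) R.
  move=> b; have [Jb|nJ] := pselect (J b); last by exists (fun _ _ => True).
  by have [R] := gC b Jb; exists R.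
pose W := \bigcup_(b in J) C b.
pose first x b := [/\ J b, C b x & forall c, J c -> C c x -> c <> b -> lt b c].
have ex x : W x -> exists b, first x b.
  move=> [b Jb Cb].
  have [|| c [Jc Cc] cmin] := hmin [set b | J b /\ C b x]; [by []|by exists b|].
  by exists c; split=> // b' Jb' Cb'; apply: cmin.
have uniq x b c : first x b -> first x c -> b = c.
  move=> [Jb Cb bm] [Jc Cc cm]; apply: contrapT => bc.
  by apply: (asym b c I I (bm c Jc Cc _) (cm b Jb Cb _)) => //; exact/nesym.
pose R x y := exists b c, [/\ first x b, first y c & lt b c \/ (b = c /\ Q b x y)].
have irr b : ~ lt b b by move=> bb; exact: (asym b b I I bb bb).
exists R; first split.
- move=> A AW [x0 Ax0].
  have [b0 fb0] := ex _ (AW _ Ax0).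
  have [|| b [x Ax fx] bmin] := hmin [set b | exists2 x, A x & first x b].
  + by [].
  + by exists b0, x0.
  have [Jb Cbx _] := fx; have [[qmin _] _] := hQ b Jb.
  have [|| y [Ay fy] ymin] := qmin [set y | A y /\ first y b].
  + by move=> y [_ []].
  + by exists x.
  exists y => // z Az zy; have [c fz] := ex _ (AW _ Az).
  exists b, c; split=> //; have [cb|cb] := pselect (c = b).
    by right; split=> //; apply: ymin => //; split=> //; rewrite -cb.
  by left; apply: bmin => //; exists z.
- move=> x y _ _ [b [c [fx fy h]]] [c' [b' [fy' fx' h']]].
  move: h'; rewrite (uniq _ _ _ fy' fy) (uniq _ _ _ fx' fx) => h' {c' b' fy' fx'}.
  case: h fx h' => [bc|[-> q]] fx [cb|[e q']].
  + exact: (asym b c).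
  + by move: bc; rewrite e; exact: irr.
  + exact: irr cb.
  + have [Jc Ccy _] := fy; have [_ Ccx _] := fx; have [[_ qasym] _] := hQ c Jc.
    exact: qasym Ccx Ccy q q'.
- move=> x Wx; have [b fx] := ex x Wx; have [Jb Cbx bm] := fx.
  pose D := \bigcup_(c in [set c | J c /\ lt c b]) C c.
  have cD : graph_closed adj d D.
    apply: graph_closed_directed => // [c c' [Jc cb] [Jc' cb']|c []]; last by move=> /cC.
    have [<-|ne] := pselect (c = c'); first by exists c; split.
    have [cc|cc] := well_orders_total hlt I I ne.
      by exists c'; split=> //; exact: mono.
    by exists c; split=> //; exact: mono.
  have fD : finite_set (D `&` adj x).
    apply: contrapT => /(@infinite_subset_II _ _ d)[A AD Ad].
    have [c [Jc cb] Ccx] : D x by apply: cD Ad _ => a /AD[].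
    have ne : c <> b by move=> e; move: cb; rewrite e; exact: irr.
    exact: (asym c b I I cb (bm c Jc Ccx ne)).
  have [_ fQ] := hQ b Jb.
  apply: sub_finite_set (_ : finite_set ((D `&` adj x) `|` [set y | [/\ C b y, Q b y x & adj x y]])).
    move=> y [Wy [c [b' [fy fx' h]]] xy]; have [Jc Ccy _] := fy.
    move: h; rewrite (uniq _ _ _ fx' fx) => -[cb|[cb q]].
      by left; split=> //; exists c.
    by right; rewrite -cb; split=> //; rewrite cb.
  by rewrite finite_setU; split=> //; exact: fQ.
Qed.

(* Keeping a countable set [X] of extra generators makes the induction go through at every [a] without
   cardinal arithmetic: the members of the chain are generated by [X], one point [b] and the segment
   below [b]. *)
Lemma orderable_graph_closure (V : Type) (adj : V -> V -> Prop) (d : nat) (lt : V -> V -> Prop) (a : V) (X : set V) :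
  0 < d -> sparse adj d -> well_orders setT lt -> countable X ->
  orderable adj (graph_closure adj d (X `|` lt^~ a)).
Proof.
move=> d0 sp hlt; move: X.
elim: (well_orders_wf hlt a) => {}a _ IH X cX.
(* If nothing precedes [a], the countable set [X] generates everything; otherwise the member at [b0]
   ensures that the chain covers [X]. *)
have [[b0 b0a]|nb] := pselect (exists b, lt b a); last first.
  apply: countable_orderable; apply: countable_graph_closure => //.
  apply: sub_countable cX; apply: subset_card_le => v [//|va].
  by case: nb; exists v.
pose C b := graph_closure adj d ((X `|` [set b]) `|` lt^~ b).
have CS b := @graph_closureS V adj d ((X `|` [set b]) `|` lt^~ b).
have mono b c : lt b c -> C b `<=` C c.
  move=> bc; apply: graph_closure_sub; first exact: graph_closure_closed.
  apply: subset_trans (CS c) => v [[Xv| ->]|vb]; first by left; left.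
    by right.
  by right; exact: well_orders_trans hlt vb bc.
have gC : orderable adj (\bigcup_(b in lt^~ a) C b).
  apply: (orderable_chain d0 hlt) => [b c _ _|b _|b ba].
  - exact: mono.
  - exact: graph_closure_closed.
  (* The induction hypothesis at [b] is used with [b] moved into the extra generators. *)
  - by apply: IH => //; apply: countable_setU => //; exact: countable1.
apply: orderable_sub gC; apply: graph_closure_sub.
  apply: graph_closed_directed => // [b c ba ca|b _]; last exact: graph_closure_closed.
  have [<-|bc] := pselect (b = c); first by exists b; split.
  have [h|h] := well_orders_total hlt I I bc.
    by exists c; split=> //; exact: mono.
  by exists b; split=> //; exact: mono.
move=> v [Xv|va].
  by exists b0 => //; apply: CS; left; left.
by exists v => //; apply: CS; left; right.
Qed.

(** The chain now runs over all vertices, and each [b] generates its own member, so none is lost. *)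
Lemma sparse_orderable (V : Type) (adj : V -> V -> Prop) (d : nat) :
  0 < d -> sparse adj d -> orderable adj setT.
Proof.
move=> d0 sp; have [lt hlt] := well_orders_exists V.
pose C b := graph_closure adj d ([set b] `|` lt^~ b).
have CS b := @graph_closureS V adj d ([set b] `|` lt^~ b).
apply: (@orderable_sub _ _ _ (\bigcup_(b in setT) C b)) => [v _|].
  by exists v => //; apply: CS; left.
apply: (orderable_chain d0 hlt) => [b c _ _ bc|b _|b _].
- apply: graph_closure_sub; first exact: graph_closure_closed.
  apply: subset_trans (CS c) => v [->|vb]; first by right.
  by right; exact: well_orders_trans hlt vb bc.
- exact: graph_closure_closed.
- by apply: orderable_graph_closure => //; exact: countable1.
Qed.

(** * Colourings with countably many colours *)

(** [Z y z] asks [y] to avoid the colour of the earlier vertex [z]; finitely many forbidden colours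
    always leave a free one. *)
Lemma greedy_colouring (V : Type) (R Z : V -> V -> Prop) : well_founded R ->
  (forall y, finite_set [set z | R z y /\ Z y z]) ->
  exists f : V -> nat, forall y z, R z y -> Z y z -> f z <> f y.
Proof.
move=> wf fin.
pose bad y (rec : forall z, R z y -> nat) := [set n | exists z (h : R z y), Z y z /\ rec z h = n].
have fresh y rec : exists n, ~ bad y rec n.
  apply: contrapT => nn; apply: infinite_nat.
  (* A total version of [rec], whose image of a finite set covers the forbidden colours; the default
     0 occurs only off the predecessors of [y]. *)
  pose g z := if pselect (R z y) is left h then rec z h else 0.
  apply: sub_finite_set (finite_image g (fin y)) => n _.
  have [z [h [Zz <-]]] : bad y rec n by apply: contrapT => nb; apply: nn; exists n.
  exists z => //; rewrite /g; case: pselect => // h'; congr (rec z _); exact: Prop_irrelevance.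
pose step y rec := sval (cid (fresh y rec)).
have stepP y rec : ~ bad y rec (step y rec) := svalP (cid (fresh y rec)).
pose f := Fix wf (fun _ => nat) step.
have fE y : f y = step y (fun z _ => f z).
  apply: (Fix_eq wf (fun _ => nat) step) => x g g' gg; congr step.
  by apply: functional_extensionality_dep => z; apply: functional_extensionality_dep.
exists f => y z Rzy Zyz; rewrite [f y]fE => e.
by apply: (stepP y (fun z _ => f z)); exists z, Rzy.
Qed.

(** Every subset of [U] is a vertex; those outside [F] are isolated. *)
Definition incidence (U : Type) (F : set (set U)) (v w : U + set U) : Prop :=
  match v, w with
  | inl x, inr A | inr A, inl x => F A /\ A x
  | _, _ => False
  end.

(** As [d > 1], a [d]-set has two distinct vertices. Two sets have only finitely many common points;
    a point and a set have no common neighbour; and if [d] points have one, it is unique by almost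
    disjointness. *)
Lemma sparse_incidence (U : Type) (F : set (set U)) (d : nat) : 1 < d ->
  (forall A B, F A -> F B -> A <> B -> ~ (`I_d #<= A `&` B)) ->
  sparse (incidence F) d.
Proof.
move=> hd hF S Sd; set adj := incidence F.
have fin A B : F A -> F B -> A <> B -> finite_set (A `&` B).
  move=> FA FB AB; apply: contrapT => /(@infinite_subset_II _ _ d)[X XAB Xd].
  by apply: (hF A B) => //; rewrite -(card_le_eql Xd); exact: subset_card_le.
have [s Ss [s' Ss' ss]] : exists2 s, S s & exists2 s', S s' & s' <> s.
  case: d hd Sd {hF fin} => [|[|d]] // _ /eq_cardSP[s Ss /eq_cardSP[s' [Ss' ne] _]].
  by exists s => //; exists s'.
case: s Ss ss => [x|A] Ss; case: s' Ss' => [x'|B] Ss' ss.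
- have one v w : S `<=` adj v -> S `<=` adj w -> v = w.
    move=> Sv Sw; apply: contrapT => vw.
    case: v Sv vw => [y Sv|A Sv]; first by have := Sv _ Ss.
    case: w Sw => [y Sw|B Sw] vw; first by have := Sw _ Ss.
    have [FA _] := Sv _ Ss; have [FB _] := Sw _ Ss.
    apply: (hF A B) => // [e|]; first by apply: vw; rewrite e.
    rewrite -(card_le_eql Sd).
    apply: (@card_le_trans _ _ _ (inl @` (A `&` B))); last exact: card_image_le.
    apply: subset_card_le => -[z Sz|C Sz]; last by have := Sv _ Sz.
    by exists z => //; split; [have [] := Sv _ Sz|have [] := Sw _ Sz].
  have [[v Sv]|nv] := pselect (exists v, S `<=` adj v).
    apply: sub_countable (countable1 v); apply: subset_card_le => w Sw; exact: one.
  apply: sub_countable (countable0 (U + set U)); apply: subset_card_le => w Sw.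
  by case: nv; exists w.
- apply: sub_countable (countable0 (U + set U)); apply: subset_card_le => -[y|C] Sv.
    by have := Sv _ Ss.
  by have := Sv _ Ss'.
- apply: sub_countable (countable0 (U + set U)); apply: subset_card_le => -[y|C] Sv.
    by have := Sv _ Ss'.
  by have := Sv _ Ss.
- have [[FA FB]|nF] := pselect (F A /\ F B).
    have AB : A <> B by move=> e; apply: ss; rewrite e.
    apply: finite_set_countable; apply: sub_finite_set (finite_image inl (fin _ _ FA FB AB)).
    move=> [y|C] Sv; last by have := Sv _ Ss.
    by exists y => //; split; [have [] := Sv _ Ss|have [] := Sv _ Ss'].
  apply: sub_countable (countable0 (U + set U)); apply: subset_card_le => -[y|C] Sv.
    by case: nF; split; [have [] := Sv _ Ss|have [] := Sv _ Ss'].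
  by have := Sv _ Ss.
Qed.

(* Order points and sets together. The first point after [A] gets a colour avoided by the finitely
   many points of [A] before [A] and by all later points of [A]; each point obeys finitely many such
   constraints. *)
Lemma almost_disjoint_cf (U : Type) (F : set (set U)) (d : nat) : 1 < d ->
  (forall A, F A -> infinite_set A) ->
  (forall A B, F A -> F B -> A <> B -> ~ (`I_d #<= A `&` B)) ->
  exists f : U -> nat, conflict_free f F.
Proof.
move=> hd hI hF.
have [R hR fin] := sparse_orderable (ltnW hd) (sparse_incidence hd hF).
have [hmin asym] := hR.
have trans x y z := @well_orders_trans _ R x y z hR.
have irr x : ~ R x x by move=> xx; exact: (asym x x I I xx xx).
pose pivot A y := [/\ A y, R (inr A) (inl y) & forall z, A z -> R (inr A) (inl z) -> z <> y -> R (inl y) (inl z)].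
have finl A : F A -> finite_set [set y | A y /\ R (inl y) (inr A)].
  move=> FA; apply: contrapT => /infiniteP /cardT_le_embeds[g gI].
  apply: (@infiniteP _ _).2 (fin (inr A) I); apply/cardT_le_embeds.
  have h y : [set y | A y /\ R (inl y) (inr A)] y -> [set y | [/\ setT y, R y (inr A) & incidence F (inr A) y]] (inl y).
    by move=> [Ay Ry]; split.
  exists (fun n => exist _ _ (h _ (svalP (g n)))) => n m e.
  by have [/sval_inj /gI] := congr1 sval e.
have finr y : finite_set [set A | [/\ F A, A y & R (inr A) (inl y)]].
  apply: contrapT => /infiniteP /cardT_le_embeds[g gI].
  apply: (@infiniteP _ _).2 (fin (inl y) I); apply/cardT_le_embeds.
  have h A : [set A | [/\ F A, A y & R (inr A) (inl y)]] A -> [set v | [/\ setT v, R v (inl y) & incidence F (inl y) v]] (inr A).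
    by move=> [FA Ay Ry]; split.
  exists (fun n => exist _ _ (h _ (svalP (g n)))) => n m e.
  by have [/sval_inj /gI] := congr1 sval e.
have pivotP A : F A -> exists y, pivot A y.
  move=> FA.
  (* Only finitely many points of the infinite set [A] precede [A]. *)
  have [y Ay Ry] : exists2 y, A y & R (inr A) (inl y).
    apply: contrapT => nn; apply: (hI A FA); apply: sub_finite_set (finl A FA) => y Ay; split=> //.
    have [] := well_orders_total hR I I (_ : inl y <> inr A) => // Ry.
    by case: nn; exists y.
  have [|| v [z [Az Rz]] <- zmin] := hmin [set v | exists2 z, A z /\ R (inr A) (inl z) & inl z = v].
  - by [].
  - by exists (inl y), y.
  exists z; split=> // w Aw Rw wz; apply: zmin; first by exists w.
  by move=> [].
have pivotU A y z : pivot A y -> pivot A z -> y = z.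
  move=> [Ay Ry ym] [Az Rz zm]; apply: contrapT => yz.
  apply: (asym (inl y) (inl z) I I (ym z Az Rz _) (zm y Ay Ry _)) => //; exact/nesym.
pose Z y z := exists2 A, F A /\ (A y /\ A z) & (pivot A z /\ R (inr A) (inl y)) \/ (pivot A y /\ R (inl z) (inr A)).
have [||f fP] := @greedy_colouring U (fun x y => R (inl x) (inl y)) Z.
- exact: Inverse_Image.wf_inverse_image (well_orders_wf hR).
- move=> y; pose S := [set A | [/\ F A, A y & R (inr A) (inl y)]].
  (* In both kinds of constraint [A] precedes [y], so finitely many sets matter; each contributes
     its pivot and its finitely many points before it. *)
  apply: sub_finite_set (_ : finite_set (\bigcup_(A in S) ([set z | pivot A z] `|` [set z | A z /\ R (inl z) (inr A)]))).
    move=> z [Rzy [A [FA [Ay Az]] [[pz Ry]|[py Rz]]]]; exists A.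
    + by split.
    + by left.
    + by have [] := py; split.
    + by right.
  apply: bigcup_finite => [|A [FA _ _]]; first exact: finr.
  rewrite finite_setU; split; last exact: finl.
  have [p pA] := pivotP A FA; apply: sub_finite_set (finite_set1 p) => z pz; exact: pivotU pz pA.
exists f => A FA; have [p pA] := pivotP A FA; have [Ap Rp pmin] := pA.
exists (f p), p; split=> // x [Ax fx]; apply: contrapT => px.
have [//|xA|Ax'] := well_orders_total hR I I (_ : inl x <> inr A).
  by apply: (fP p x (trans _ _ _ xA Rp) _ fx); exists A; [split|right].
have Rpx : R (inl p) (inl x) by apply: pmin => //; exact/nesym.
by apply: (fP x p Rpx _ (esym fx)); exists A; [split|left].
Qed.

(* chi_CF(beth_omega(kappa), kappa, d) = omega:
   every such system has a conflict free colouring with at most omega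
   (here: nat-many) colours, and for no finite n is n colours enough
   for all such systems. *)
Theorem theorem6p5 (K : Type) (hK : infinite_set [set: K]) (d : nat) (hd : 1 < d) :
  (forall (U : Type) (F : set (set U)), beth_omega_system K d F ->
     exists f : U -> nat, conflict_free f F) /\
  (forall n : nat, exists (U : Type) (F : set (set U)),
     beth_omega_system K d F /\ ~ (exists f : U -> 'I_n, conflict_free f F)).
Proof.
split=> [U F [_ [cF [_ dF]]]|n]; last exact: uncolourable_beth_omega_system.
apply: (almost_disjoint_cf hd) dF => A /cF cA.
by rewrite (eq_finite_set cA).
Qed.
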